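(* For every integer $m\ge 1$, the directed multigraph ${\cal D}^*_m$ is disconnected, and each of its connected components is strongly connected.
   Context: Alpha-letters (2-element subsets of the directions up, down, left, right): $a=\{\text{right},\text{down}\}$, $b=\{\text{up},\text{down}\}$, $c=\{\text{right},\text{up}\}$, $d=\{\text{left},\text{down}\}$, $e=\{\text{left},\text{right}\}$, $f=\{\text{left},\text{up}\}$. ${\cal D}_{ud}$: arc $(\alpha,\beta)$ iff ($\text{down}\in\alpha\iff\text{up}\in\beta$); ${\cal D}_{lr}$: arc $(\alpha,\beta)$ iff ($\text{right}\in\alpha\iff\text{left}\in\beta$). ${\cal D}_m$: vertices are the words $\alpha_1\cdots\alpha_m\in\{a,\dots,f\}^m$ with $(\alpha_i,\alpha_{i+1})$ an arc of ${\cal D}_{ud}$ for $1\le i\le m$ ($\alpha_{m+1}:=\alpha_1$); arc $v\to u$ iff $(v_i,u_i)$ is an arc of ${\cal D}_{lr}$ for all $i$. Outlet word $o(\alpha)\in\{0,1\}^m$: $o_j=1$ iff $\alpha_j\in\{a,c,e\}$; inlet word $i(\alpha)$: $i_j=1$ iff $\alpha_j\in\{d,e,f\}$. ${\cal D}^*_m$ is obtained from ${\cal D}_m$ by merging vertices with a common outlet word: vertex set $\{o(x):x\in V({\cal D}_m)\}$, and the number of arcs from $v$ to $w$ equals $|\{y\in V({\cal D}_m): i(y)=v,\ o(y)=w\}|$. Connected components are those of the underlying undirected multigraph. *)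

(* Defs.v *)
From HB Require Import structures.
From mathcomp Require Import all_boot.

Set Implicit Arguments.
Unset Strict Implicit.
Unset Printing Implicit Defensive.

(* Finite directed multigraphs, loops and parallel arcs allowed; [narcs G x y]
   is the number of arcs from [x] to [y]. *)
Record multidigraph := MultiDigraph {
  vertex : finType;
  narcs : vertex -> vertex -> nat
}.

Definition has_arc (G : multidigraph) : rel (vertex G) :=
  fun x y => 0 < narcs x y.

Definition adjacent (G : multidigraph) : rel (vertex G) :=
  fun x y => has_arc x y || has_arc y x.

Definition components (G : multidigraph) : {set {set vertex G}} :=
  equivalence_partition (connect (@adjacent G)) [set: vertex G].

Definition disconnected (G : multidigraph) : Prop := 1 < #|components G|.

Definition strongly_connected (G : multidigraph) : Prop :=
  forall x y : vertex G, connect (@has_arc G) x y.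

Definition induced (G : multidigraph) (C : {set vertex G}) : multidigraph :=
  @MultiDigraph {x : vertex G | x \in C} (fun x y => narcs (val x) (val y)).

Inductive direction := Up | Down | Left | Right.

Definition nat_of_direction (x : direction) : nat :=
  match x with Up => 0 | Down => 1 | Left => 2 | Right => 3 end.

Definition ord_of_direction (x : direction) : 'I_4 :=
  inord (nat_of_direction x).

Definition direction_of_ord (i : 'I_4) : direction :=
  nth Up [:: Up; Down; Left; Right] i.

Lemma ord_of_directionK : cancel ord_of_direction direction_of_ord.
Proof. by case; rewrite /direction_of_ord inordK. Qed.

HB.instance Definition _ :=
  Finite.copy direction (can_type ord_of_directionK).

Inductive letter :=
  Letter_a | Letter_b | Letter_c | Letter_d | Letter_e | Letter_f.

Definition nat_of_letter (x : letter) : nat :=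
  match x with
  | Letter_a => 0 | Letter_b => 1 | Letter_c => 2
  | Letter_d => 3 | Letter_e => 4 | Letter_f => 5
  end.

Definition ord_of_letter (x : letter) : 'I_6 := inord (nat_of_letter x).

Definition letter_of_ord (i : 'I_6) : letter :=
  nth Letter_a
    [:: Letter_a; Letter_b; Letter_c; Letter_d; Letter_e; Letter_f] i.

Lemma ord_of_letterK : cancel ord_of_letter letter_of_ord.
Proof. by case; rewrite /letter_of_ord inordK. Qed.

HB.instance Definition _ := Finite.copy letter (can_type ord_of_letterK).

Definition dirs (x : letter) : {set direction} :=
  match x with
  | Letter_a => [set Right; Down]
  | Letter_b => [set Up; Down]
  | Letter_c => [set Right; Up]
  | Letter_d => [set Left; Down]
  | Letter_e => [set Left; Right]
  | Letter_f => [set Left; Up]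
  end.

Definition D_ud : rel letter :=
  fun x y => (Down \in dirs x) == (Up \in dirs y).

Definition D_lr : rel letter :=
  fun x y => (Right \in dirs x) == (Left \in dirs y).

(* [ordS i] is the cyclic successor of [i], so the last letter is compared with
   the first one. *)
Definition D_vertices (m : nat) : {set m.-tuple letter} :=
  [set x : m.-tuple letter | [forall i, D_ud (tnth x i) (tnth x (ordS i))]].

Definition D_arc (m : nat) : rel (m.-tuple letter) :=
  fun x y => [forall i, D_lr (tnth x i) (tnth y i)].

Definition outlet (m : nat) (x : m.-tuple letter) : m.-tuple bool :=
  [tuple of map (fun l => l \in [:: Letter_a; Letter_c; Letter_e]) x].

Definition inlet (m : nat) (x : m.-tuple letter) : m.-tuple bool :=
  [tuple of map (fun l => l \in [:: Letter_d; Letter_e; Letter_f]) x].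

(* The arcs of the merged graph are counted below by inlet and outlet words;
   this is why that is the quotient of the digraph with arcs [D_arc]. *)
Lemma D_arcE (m : nat) (x y : m.-tuple letter) :
  D_arc x y = (outlet x == inlet y).
Proof.
have lrE l k : D_lr l k = ((l \in [:: Letter_a; Letter_c; Letter_e])
                        == (k \in [:: Letter_d; Letter_e; Letter_f])).
  have neq (s t : direction) : (s == t) = (ord_of_direction s == ord_of_direction t).
    by rewrite (can_eq ord_of_directionK).
  have neql (s t : letter) : (s == t) = (ord_of_letter s == ord_of_letter t).
    by rewrite (can_eq ord_of_letterK).
  by rewrite /D_lr; case: l; case: k; rewrite /= !inE !neq !neql -!val_eqE /= !inordK.
apply/forallP/eqP => [xy | xy i].
  by apply: eq_from_tnth => i; rewrite !tnth_map; apply/eqP; rewrite -lrE.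
by rewrite lrE; have /eqP := congr1 (fun t => tnth t i) xy; rewrite !tnth_map.
Qed.

Definition Dstar (m : nat) : multidigraph :=
  @MultiDigraph {w : m.-tuple bool | w \in [set outlet x | x in D_vertices m]}
    (fun v w => #|[set y in D_vertices m |
                    (inlet y == val v) && (outlet y == val w)]|).

(* Main.v *)
(** Exchanging left and right in every letter is an involution of the vertices
    of D_m that swaps inlet and outlet words, so the arc relation of D*_m is
    symmetric; hence connected components are strongly connected.  Each letter
    has two directions, and going around the cyclic word every up is matched
    with a down, so the inlet and outlet words of a vertex have the same parity.
    Both parities occur: the word b...b has outlet 0...0 and the word cdb...b
    (the word e if m = 1) has outlet 10...0. *)

Require Import Defs.
From mathcomp Require Import all_boot.

Set Implicit Arguments.
Unset Strict Implicit.
Unset Printing Implicit Defensive.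

Section SymmetricMultidigraph.

Variables (G : multidigraph) (arc_sym : symmetric (@has_arc G)).

Lemma adjacent_has_arc : @adjacent G =2 @has_arc G.
Proof. by move=> x y; rewrite /adjacent (arc_sym y) orbb. Qed.

Lemma connect_has_arc_sym : connect_sym (@has_arc G).
Proof. exact: sym_connect_sym. Qed.

(** Symmetry makes adjacency coincide with [has_arc], so components are exactly the sets of vertices
    reachable by directed paths. *)
Lemma componentsP (C : {set vertex G}) :
  reflect (exists x, C = [set y | connect (@has_arc G) x y])
          (C \in components G).
Proof.
apply: (iffP imsetP) => [[x _ ->]|[x ->]]; exists x => //;
  by apply/setP => y; rewrite !inE /= (eq_connect adjacent_has_arc).
Qed.

(** A component is closed under arcs, so a directed path of [G] starting in [C] never leaves it; it
    lifts to [induced C] arc by arc. *)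
Lemma component_strongly_connected (C : {set vertex G}) :
  C \in components G -> strongly_connected (induced C).
Proof.
case/componentsP => x0 defC x y.
have memC z : (z \in C) = connect (@has_arc G) x0 z by rewrite defC inE.
have: connect (@has_arc G) (val x) (val y).
  have:= valP x; have:= valP y; rewrite /= !memC => cy.
  by rewrite connect_has_arc_sym => /connect_trans; apply.
case/connectP => p; elim: p x => [|z p IHp] x /=.
  by move=> _ /val_inj->; apply: connect0.
case/andP=> xz zp def_y.
have zC : z \in C.
  have:= valP x; rewrite /= !memC => /connect_trans; apply.
  exact: connect1.
apply: (@connect_trans _ _ (Sub z zC : vertex (induced C))).
  exact: connect1.
exact: IHp.
Qed.

(** A function preserved by arcs is constant on reachability sets, so the sets of [x] and [y] are
    distinct components. *)
Lemma disconnected_invariant (f : pred (vertex G)) (x y : vertex G) :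
  (forall u v, has_arc u v -> f u = f v) -> f x != f y -> disconnected G.
Proof.
move=> f_arc neq_f; apply/card_gt1P.
exists [set z | connect (@has_arc G) x z], [set z | connect (@has_arc G) y z].
split; try by apply/componentsP; eexists.
apply: contra_neq neq_f => /setP/(_ y); rewrite !inE connect0.
by move/(closed_connect (a := f) f_arc).
Qed.

End SymmetricMultidigraph.

(** These two membership tests are written as in [inlet] and [outlet], so that entries of those
    words fold to them. *)
Definition left_bit (l : letter) := l \in [:: Letter_d; Letter_e; Letter_f].
Definition right_bit (l : letter) := l \in [:: Letter_a; Letter_c; Letter_e].
Definition up_bit (l : letter) := Up \in dirs l.
Definition down_bit (l : letter) := Down \in dirs l.

Definition mirror (l : letter) : letter :=
  match l with
  | Letter_a => Letter_d | Letter_c => Letter_f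
  | Letter_d => Letter_a | Letter_f => Letter_c
  | _ => l
  end.

(** Equality is transported through [inord], which blocks computation; comparing numeric codes lets
    the case analyses close. *)
Lemma directionE (s t : direction) :
  (s == t) = (nat_of_direction s == nat_of_direction t).
Proof.
by rewrite -(can_eq ord_of_directionK) -val_eqE; case: s; case: t;
  rewrite /= !inordK.
Qed.

Lemma letterE (s t : letter) : (s == t) = (nat_of_letter s == nat_of_letter t).
Proof.
by rewrite -(can_eq ord_of_letterK) -val_eqE; case: s; case: t;
  rewrite /= !inordK.
Qed.

Lemma left_mirror l : left_bit (mirror l) = right_bit l.
Proof. by case: l; rewrite /left_bit /right_bit !inE !letterE. Qed.

Lemma right_mirror l : right_bit (mirror l) = left_bit l.
Proof. by case: l; rewrite /left_bit /right_bit !inE !letterE. Qed.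

Lemma up_mirror l : up_bit (mirror l) = up_bit l.
Proof. by case: l; rewrite /up_bit /= !inE !directionE. Qed.

Lemma down_mirror l : down_bit (mirror l) = down_bit l.
Proof. by case: l; rewrite /down_bit /= !inE !directionE. Qed.

(** The four direction bits of a letter sum to zero modulo 2, since exactly two are set. *)
Lemma right_bitE l :
  right_bit l = left_bit l (+) (up_bit l (+) down_bit l).
Proof.
by case: l; rewrite /left_bit /right_bit /up_bit /down_bit /= !inE
  !letterE !directionE.
Qed.

Section Words.

Variable m : nat.
Implicit Types x y : m.-tuple letter.

Lemma D_verticesP x :
  reflect (forall i, down_bit (tnth x i) = up_bit (tnth x (ordS i)))
          (x \in D_vertices m).
Proof. by rewrite inE; apply: (iffP forallP) => h i; apply/eqP/h. Qed.

Definition mirror_word x : m.-tuple letter := [tuple of map mirror x].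

Lemma mirror_word_vertex x : x \in D_vertices m -> mirror_word x \in D_vertices m.
Proof.
by move/D_verticesP => xP; apply/D_verticesP => i;
  rewrite !tnth_map down_mirror up_mirror.
Qed.

Lemma inlet_mirror x : inlet (mirror_word x) = outlet x.
Proof. by apply: eq_from_tnth => i; rewrite !tnth_map; apply: left_mirror. Qed.

Lemma outlet_mirror x : outlet (mirror_word x) = inlet x.
Proof. by apply: eq_from_tnth => i; rewrite !tnth_map; apply: right_mirror. Qed.

Lemma Dstar_arcP (v w : vertex (Dstar m)) :
  reflect (exists2 y, y \in D_vertices m & inlet y = val v /\ outlet y = val w)
          (has_arc v w).
Proof.
apply: (iffP card_gt0P) => [[y]|[y yV [yv yw]]].
  by rewrite inE => /andP[yV /andP[/eqP yv /eqP yw]]; exists y.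
by exists y; rewrite inE yV yv yw !eqxx.
Qed.

Lemma Dstar_sym : symmetric (@has_arc (Dstar m)).
Proof.
suff sub (v w : vertex (Dstar m)) : has_arc v w -> has_arc w v.
  by move=> v w; apply/idP/idP; apply: sub.
case/Dstar_arcP=> y yV [yv yw]; apply/Dstar_arcP; exists (mirror_word y).
  exact: mirror_word_vertex.
by rewrite inlet_mirror outlet_mirror.
Qed.

Definition parity (w : m.-tuple bool) : bool := \big[addb/false]_i tnth w i.

Lemma parity_outlet x : x \in D_vertices m -> parity (outlet x) = parity (inlet x).
Proof.
move/D_verticesP=> xP; rewrite /parity.
under eq_bigr => i _ do rewrite tnth_map -/(right_bit _) right_bitE.
under [RHS]eq_bigr => i _ do rewrite tnth_map -/(left_bit _).
(* Each down bit becomes the up bit of the next letter; reindexing the up bits by the cyclic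
   successor then makes both sums equal, and they cancel. *)
rewrite !big_split /= [X in _ (+) (_ (+) X)](eq_bigr _ (fun i _ => xP i)).
rewrite [X in _ (+) (X (+) _)](reindex_inj (@ordS_inj m)).
by rewrite addbb addbF.
Qed.

Lemma parity_arc (v w : vertex (Dstar m)) :
  has_arc v w -> parity (val v) = parity (val w).
Proof. by case/Dstar_arcP=> y yV [<- <-]; rewrite parity_outlet. Qed.

End Words.

Definition straight_word (m : nat) : m.-tuple letter := [tuple of nseq m Letter_b].

Lemma straight_word_vertex m : straight_word m \in D_vertices m.
Proof.
by apply/D_verticesP => i; rewrite !tnth_nseq /up_bit /down_bit /= !inE !directionE.
Qed.

Lemma parity_straight_word m : parity (outlet (straight_word m)) = false.
Proof. by apply: big1 => i _; rewrite tnth_map tnth_nseq !inE !letterE. Qed.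

(* The letter with the given left and right bits whose up and down bits are
   their respective complements. *)
Definition bend (l r : bool) : letter :=
  if l then if r then Letter_e else Letter_d
  else if r then Letter_c else Letter_b.

(* The word cdb...b, or e for m = 1. *)
Definition bent_word (n : nat) : n.+1.-tuple letter :=
  [tuple bend (i == ordS ord0) (i == ord0) | i < n.+1].

Lemma bent_word_vertex n : bent_word n \in D_vertices n.+1.
Proof.
have up_bend l r : up_bit (bend l r) = ~~ l.
  by case: l; case: r; rewrite /up_bit /= !inE !directionE.
have down_bend l r : down_bit (bend l r) = ~~ r.
  by case: l; case: r; rewrite /down_bit /= !inE !directionE.
apply/D_verticesP => i.
(* The condition reduces to [ordS i == ordS ord0] agreeing with [i == ord0]. This also covers length
   1, where [ordS ord0] is [ord0]. *)
by rewrite !tnth_mktuple up_bend down_bend (inj_eq (@ordS_inj _)).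
Qed.

Lemma parity_bent_word n : parity (outlet (bent_word n)) = true.
Proof.
have right_bend l r : right_bit (bend l r) = r.
  by case: l; case: r; rewrite /right_bit !inE !letterE.
(* Only the letter at [ord0] has its right bit set. *)
rewrite /parity (bigD1 ord0) //= big1 => [|i /negPf ni0];
  by rewrite tnth_map tnth_mktuple -/(right_bit _) right_bend.
Qed.

Theorem theorem2 (m : nat) (m_ge1 : 1 <= m) :
  disconnected (Dstar m) /\
  (forall C : {set vertex (Dstar m)},
     C \in components (Dstar m) -> strongly_connected (induced C)).
Proof.
split; last by move=> C; apply: component_strongly_connected (@Dstar_sym m) _.
(* Positivity of the length supplies the position [ord0] used by the bent word. *)
case: m m_ge1 => // n _.
pose even_v : vertex (Dstar n.+1) :=
  Sub (outlet (straight_word n.+1)) (imset_f _ (straight_word_vertex n.+1)).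
pose odd_v : vertex (Dstar n.+1) :=
  Sub (outlet (bent_word n)) (imset_f _ (bent_word_vertex n)).
apply: (disconnected_invariant (@Dstar_sym _) (x := even_v) (y := odd_v)
          (@parity_arc n.+1)).
by rewrite /= parity_straight_word parity_bent_word.
Qed.
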